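(* Let $M$ be a linear subspace, with countable co-dimension, of a barreled extended locally convex space $(X,\tau)$. Then $M$ is barreled, i.e. $(M,\tau|_M)$ is barreled.
   Context: Vector spaces are over $\mathbb{K}\in\{\mathbb{R},\mathbb{C}\}$. An extended seminorm on a vector space $X$ is a map $\rho:X\to[0,\infty]$ with $\rho(\alpha x)=|\alpha|\rho(x)$ (convention $0\cdot\infty=0$) and $\rho(x+y)\le\rho(x)+\rho(y)$. An extended locally convex space (elcs) is a vector space $X$ with a Hausdorff topology $\tau$ induced by a family $\mathcal{P}$ of extended seminorms, i.e. the sets $\{y\in X:\rho(y-x)<\epsilon\}$ ($\rho\in\mathcal{P}$, $x\in X$, $\epsilon>0$) form a subbase of $\tau$. A barrel in an elcs is a closed, absolutely convex (balanced and convex), absorbing subset; an elcs is barreled if every barrel in it is a neighborhood of $0$. $\tau|_M$ is the subspace topology. The co-dimension of $M$ is the algebraic dimension of the vector space $X/M$. *)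

(* Defs.v *)
From HB Require Import structures.
From mathcomp Require Import all_boot all_order all_algebra.
From mathcomp Require Import generic_quotient ring_quotient.
From mathcomp Require Import finmap complex.
From mathcomp Require Import all_classical all_reals topology tvs convex.

Set Implicit Arguments.
Unset Strict Implicit.
Unset Printing Implicit Defensive.

Import Order.TTheory GRing.Theory Num.Theory.

Local Open Scope classical_set_scope.
Local Open Scope ring_scope.

Variant scalar_kind := RealScalars | ComplexScalars.

Definition scalars (R : realType) (k : scalar_kind) : numFieldType :=
  match k with
  | RealScalars => R
  | ComplexScalars => R[i]
  end.

(* As for the library's norms, seminorms take their values in the scalar field
   (here extended with infinities).  For complex scalars the order of [\bar K]
   is partial and its elements [>= 0] are exactly the nonnegative reals and
   [+oo], so the first clause says that [rho] maps into [0, +oo]. The library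
   product satisfies [0 * +oo = 0]. *)
Definition extended_seminorm (K : numFieldType) (X : lmodType K)
    (rho : X -> \bar K) : Prop :=
  [/\ forall x, (0 <= rho x)%E,
      forall (a : K) x, rho (a *: x) = (`|a|%:E * rho x)%E
    & forall x y, (rho (x + y)%R <= rho x + rho y)%E].

Definition seminorm_balls (K : numFieldType) (X : lmodType K)
    (P : set (X -> \bar K)) : set (set X) :=
  [set U | exists rho (x : X) (eps : K),
    [/\ P rho, 0 < eps & U = [set y | (rho (y - x)%R < eps%:E)%E]]].

Definition is_subbase (T : topologicalType) (S : set (set T)) : Prop :=
  forall U : set T, open U <->
    exists2 D : set (set T), D `<=` finI_from S id & U = \bigcup_(A in D) A.

Definition elcs (K : numFieldType) (X : preTopologicalLmodType K) : Prop :=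
  hausdorff_space X /\
  exists2 P : set (X -> \bar K), P `<=` @extended_seminorm K X
                               & is_subbase (seminorm_balls P).

Definition balanced (K : numFieldType) (X : lmodType K) (B : set X) : Prop :=
  forall (c : K) x, `|c| <= 1 -> B x -> B (c *: x).

Definition absorbing (K : numFieldType) (X : lmodType K) (B : set X) : Prop :=
  forall x : X, exists2 r : K, 0 < r &
    forall c : K, r <= `|c| -> exists2 b, B b & x = c *: b.

Definition barrel (K : numFieldType) (X : preTopologicalLmodType K)
    (B : set X) : Prop :=
  [/\ closed B, balanced B, @convex_set K X B & absorbing B].

Definition barreled (K : numFieldType) (X : preTopologicalLmodType K) : Prop :=
  elcs X /\ forall B : set X, barrel B -> nbhs (0 : X) B.

Definition linsub (K : numFieldType) (X : preTopologicalLmodType K)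
  (M : submodClosed X) : Type := {x : X | x \in M}.

Section LinearSubspace.
Context (K : numFieldType) (X : preTopologicalLmodType K) (M : submodClosed X).

HB.instance Definition _ := SubChoice.on (linsub M).
HB.instance Definition _ := [SubChoice_isSubLmodule of linsub M by <:].
HB.instance Definition _ :=
  Topological.copy (linsub M) (initial_topology (val : linsub M -> X)).

End LinearSubspace.

Section QuotientModule.
Local Open Scope quotient_scope.
Context (K : numFieldType) (X : lmodType K) (M : submodClosed X).

(* The library's additive quotients are taken modulo a [zmodClosed] predicate,
   which [submodClosed] does not canonically provide. *)
Definition submod_pred : pred X := fun x => x \in M.

HB.instance Definition _ := GRing.isZmodClosed.Build X submod_pred
  (GRing.submod_closedB (submodClosedP M)).

Let N : zmodClosed X := GRing.ZmodClosed.clone X submod_pred _.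

Definition lmod_quot : Type := Quotient.quot N.

HB.instance Definition _ := GRing.Zmodule.on lmod_quot.
HB.instance Definition _ := EqQuotient.on lmod_quot.

Definition quot_scale (a : K) (q : lmod_quot) : lmod_quot :=
  \pi_lmod_quot (a *: repr q).

Lemma lmod_quot_eqE (x y : X) :
  (\pi_lmod_quot x == \pi_lmod_quot y) = (x - y \in M).
Proof. symmetry; exact: (@Quotient.idealrBE X N x y). Qed.

Lemma lmod_quot_piZ (a : K) (x : X) :
  quot_scale a (\pi_lmod_quot x) = \pi_lmod_quot (a *: x).
Proof.
apply/eqP; rewrite lmod_quot_eqE -scalerBr; apply: rpredZ.
by rewrite -lmod_quot_eqE reprK.
Qed.

Lemma lmod_quot_piD (x y : X) :
  \pi_lmod_quot (x + y) = \pi_lmod_quot x + \pi_lmod_quot y.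
Proof. exact: (@Quotient.pi_add X N x y). Qed.

Fact quot_scaleA a b q : quot_scale a (quot_scale b q) = quot_scale (a * b) q.
Proof.
rewrite -[q]reprK; move: (repr q) => x.
by rewrite (lmod_quot_piZ b) !lmod_quot_piZ scalerA.
Qed.

Fact quot_scale1 : left_id 1 quot_scale.
Proof. by move=> q; rewrite -[q]reprK lmod_quot_piZ scale1r. Qed.

Fact quot_scaleDr : right_distributive quot_scale +%R.
Proof.
move=> a p q; rewrite -[p]reprK -[q]reprK; move: (repr p) (repr q) => x y.
by rewrite -lmod_quot_piD !lmod_quot_piZ -lmod_quot_piD scalerDr.
Qed.

Fact quot_scaleDl q : {morph quot_scale^~ q : a b / a + b}.
Proof.
move=> a b; rewrite -[q]reprK; move: (repr q) => x.
by rewrite !lmod_quot_piZ scalerDl lmod_quot_piD.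
Qed.

HB.instance Definition _ := GRing.Zmodule_isLmodule.Build K lmod_quot
  quot_scaleA quot_scale1 quot_scaleDr quot_scaleDl.

End QuotientModule.

Definition hamel_basis (K : numFieldType) (V : lmodType K) (B : set V) : Prop :=
  (forall (F : {fset V}) (c : V -> K), [set` F] `<=` B ->
     \sum_(v <- F) c v *: v = 0 -> forall v, v \in F -> c v = 0) /\
  (forall w : V, exists (F : {fset V}) (c : V -> K),
     [set` F] `<=` B /\ w = \sum_(v <- F) c v *: v).

(* [countable] includes the finite case. *)
Definition countable_dimension (K : numFieldType) (V : lmodType K) : Prop :=
  exists2 B : set V, hamel_basis B & countable B.

Definition countable_codimension (K : numFieldType) (X : lmodType K)
  (M : submodClosed X) : Prop := countable_dimension (lmod_quot M).

(* Main.v *)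
Require Import Defs.
From mathcomp Require Import all_boot all_order all_algebra.
From mathcomp Require Import generic_quotient finmap.
From mathcomp Require Import all_classical all_reals topology tvs.
From mathcomp Require Import convex interval_inference.
From mathcomp Require Import ring.

(* The absorbing absolutely convex neighborhoods of [0] are a base for a locally
   convex topology coarser than that of [X]; closures below are taken in it.  Let [T]
   be a barrel of [M] and [C 0] its closure in [X]; inside [M] it stays within
   [2 T].  Let [e n] generate [X] modulo [M].  If [e n] is in the span of
   [C n], put [C (n+1) = C n]; otherwise let [C (n+1)] be the closure of [C n]
   plus the disk through [e n], which meets the span of [C n] in [C n] only.
   The union of the [C n] is absorbing, and barreledness of [X] makes it a
   neighborhood of [0]; its trace on [M] is that of [C 0], hence lies in [2 T]. *)

Set Implicit Arguments.
Unset Strict Implicit.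
Unset Printing Implicit Defensive.

Import Order.TTheory GRing.Theory Num.Theory.

Local Open Scope classical_set_scope.
Local Open Scope ring_scope.

(** * Absolutely convex sets and their linear spans *)

Section AbsolutelyConvex.
Context (K : numFieldType) (X : lmodType K).
Implicit Types (A B C D W : set X) (x y z e : X) (a b c r s : K).

(** Balanced and convex in one condition; [B 0] excludes the empty set. *)
Definition absconv B : Prop :=
  B 0 /\ forall a b x y, `|a| + `|b| <= 1 -> B x -> B y -> B (a *: x + b *: y).

(** For [r != 0] this is the multiple [r B]. As [0^-1 = 0], [dilate 0 B] is the whole space when
    [B 0] holds, so absolute convexity survives for every [r]. *)
Definition dilate r B : set X := [set x | B (r^-1 *: x)].

Definition msum A B : set X := [set x | exists2 b, B b & A (x - b)].

Definition disk e : set X := [set x | exists2 c, `|c| <= 1 & x = c *: e].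

(* For absolutely convex [B] this is the linear span of [B]. *)
Definition absorbed B : set X := [set x | exists2 r, 0 < r & B (r *: x)].

Lemma absconv0 B : absconv B -> B 0. Proof. by case. Qed.

Lemma absconvD B a b x y : absconv B -> `|a| + `|b| <= 1 -> B x -> B y ->
  B (a *: x + b *: y).
Proof. by case=> _; apply. Qed.

Lemma absconv_half B x y : absconv B -> B x -> B y ->
  B (2^-1 *: x + 2^-1 *: y).
Proof.
by move=> aB; apply: absconvD => //; rewrite ger0_norm ?invr_ge0// -[2^-1]mul1r -splitr.
Qed.

Lemma absconv_balanced B a x : absconv B -> `|a| <= 1 -> B x -> B (a *: x).
Proof.
move=> aB a1 Bx; rewrite -[_ *: _]addr0 -(scale0r x).
by apply: absconvD; rewrite ?normr0 ?addr0.
Qed.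

Lemma absconvN B x : absconv B -> B x -> B (- x).
Proof. by move=> aB; rewrite -scaleN1r; apply: absconv_balanced; rewrite ?normrN1. Qed.

Lemma absconv_le B r s x : absconv B -> 0 <= r <= s -> B (s *: x) -> B (r *: x).
Proof.
move=> aB /andP[r0 rs] Bs; have [s0|s0] := eqVneq s 0.
  have -> : r = 0 by apply/eqP; rewrite eq_le r0 -s0 rs.
  by rewrite scale0r; apply: absconv0.
have s_gt0 : 0 < s by rewrite lt_def s0 (le_trans r0).
rewrite -(divfK s0 r) -scalerA; apply: absconv_balanced => //.
rewrite ger0_norm; last by rewrite divr_ge0 ?(ltW s_gt0).
by rewrite ler_pdivrMr ?mul1r.
Qed.

Lemma absconvI A B : absconv A -> absconv B -> absconv (A `&` B).
Proof.
move=> aA aB; split; first by split; apply: absconv0.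
by move=> a b x y ab [Ax Bx] [Ay By]; split; apply: absconvD.
Qed.

Lemma absconv_bigcap I (D : set I) (F : I -> set X) :
  (forall i, D i -> absconv (F i)) -> absconv (\bigcap_(i in D) F i).
Proof.
move=> aF; split=> [i Di|a b x y ab Fx Fy i Di]; first exact: absconv0 (aF i Di).
exact: absconvD (aF i Di) ab (Fx i Di) (Fy i Di).
Qed.

Lemma absconv_bigcup (F : nat -> set X) :
  (forall n, absconv (F n)) -> (forall m n, (m <= n)%N -> F m `<=` F n) ->
  absconv (\bigcup_n F n).
Proof.
move=> aF mF; split=> [|a b x y ab [m _ Fx] [n _ Fy]].
  by exists 0%N => //; apply: absconv0.
exists (maxn m n) => //; apply: absconvD => //.
  exact: (mF _ _ (leq_maxl m n)).
exact: (mF _ _ (leq_maxr m n)).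
Qed.

Lemma absconv_dilate r B : absconv B -> absconv (dilate r B).
Proof.
move=> aB; split; first by rewrite /dilate/= scaler0; apply: absconv0.
move=> a b x y ab Bx By; rewrite /dilate/= scalerDr !scalerA.
by rewrite ![r^-1 * _]mulrC -!scalerA; apply: absconvD.
Qed.

Lemma absconv_msum A B : absconv A -> absconv B -> absconv (msum A B).
Proof.
move=> aA aB; split.
  by exists 0; [exact: absconv0|rewrite subr0; exact: absconv0].
move=> a b x y ab [x' Bx' Ax] [y' By' Ay]; exists (a *: x' + b *: y').
  exact: absconvD.
by rewrite opprD addrACA -!scalerBr; apply: absconvD.
Qed.

Lemma msum_subl A B : absconv B -> A `<=` msum A B.
Proof. by move=> aB x Ax; exists 0; [exact: absconv0|rewrite subr0]. Qed.

Lemma msum_subr A B : absconv A -> B `<=` msum A B.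
Proof. by move=> aA x Bx; exists x => //; rewrite subrr; exact: absconv0. Qed.

Lemma absconv_disk e : absconv (disk e).
Proof.
split=> [|a b _ _ ab [c c1 ->] [d d1 ->]].
  by exists 0; rewrite ?scale0r ?normr0.
exists (a * c + b * d); last by rewrite scalerDl !scalerA.
rewrite (le_trans (ler_normD _ _))// (le_trans _ ab)// !normrM.
by apply: lerD; apply: ler_piMr.
Qed.

Lemma disk_id e : disk e e. Proof. by exists 1; rewrite ?scale1r ?normr1. Qed.

Lemma absorbedW B : B `<=` absorbed B.
Proof. by move=> x Bx; exists 1; rewrite ?scale1r. Qed.

Lemma absorbed_sub A B : A `<=` B -> absorbed A `<=` absorbed B.
Proof. by move=> AB x [r r0 Ax]; exists r => //; apply: AB. Qed.

Lemma absorbedD B x y : absconv B -> absorbed B x -> absorbed B y ->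
  absorbed B (x + y).
Proof.
move=> aB [r r0 Bx] [s s0 By]; have rs0 : 0 < r + s by exact: addr_gt0.
exists (r * s / (r + s)); first by rewrite divr_gt0 ?mulr_gt0.
have -> : (r * s / (r + s)) *: (x + y) =
          (s / (r + s)) *: (r *: x) + (r / (r + s)) *: (s *: y).
  by rewrite scalerDr !scalerA; congr (_ *: _ + _ *: _); ring.
apply: absconvD => //; rewrite !ger0_norm ?divr_ge0 ?(ltW r0) ?(ltW s0)//;
  try exact: ltW.
by rewrite -mulrDl [s + r]addrC divff ?gt_eqF.
Qed.

Lemma absorbedZ B a x : absconv B -> absorbed B x -> absorbed B (a *: x).
Proof.
move=> aB [r r0 Bx]; have [->|a0] := eqVneq a 0.
  by rewrite scale0r; exists 1 => //; rewrite scaler0; exact: absconv0.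
exists (r / `|a|); first by rewrite divr_gt0 ?normr_gt0.
have -> : (r / `|a|) *: (a *: x) = (a / `|a|) *: (r *: x).
  by rewrite !scalerA; congr (_ *: _); ring.
by apply: absconv_balanced => //; rewrite normf_div normr_id divff ?normr_eq0.
Qed.

Lemma absorbedI A B x : absconv A -> absconv B ->
  absorbed A x -> absorbed B x -> absorbed (A `&` B) x.
Proof.
move=> aA aB [r r0 Ax] [s s0 Bx].
have rs0 : 0 < r + s by exact: addr_gt0.
have [r0' s0'] : 0 <= r /\ 0 <= s by split; exact: ltW.
(* This lies below both [r] and [s], and is found without comparing them. *)
exists (r * s / (r + s)); first by rewrite divr_gt0 ?mulr_gt0.
split; [apply: absconv_le Ax|apply: absconv_le Bx] => //;
  (apply/andP; split; first by rewrite divr_ge0 ?mulr_ge0 ?addr_ge0);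
  rewrite ler_pdivrMr//; last rewrite mulrC; apply: ler_wpM2l => //.
  by rewrite lerDr.
by rewrite lerDl.
Qed.

Lemma absorbed_dilate r B x : 0 < r -> absorbed B x -> absorbed (dilate r B) x.
Proof.
move=> r0 [s s0 Bx]; exists (r * s); first exact: mulr_gt0.
by rewrite /dilate/= !scalerA mulKf ?gt_eqF.
Qed.

(* By maximality the only obstruction to absorbing [y] is that
   [x = d + c y] with [|c|] arbitrarily small; two such expressions with
   distinct [c] put [y] in the span. *)
Lemma absorbing_avoiding W x : absconv W -> ~ W x ->
  exists D, [/\ absconv D, W `<=` D, forall y, absorbed D y & ~ D x].
Proof.
move=> aW nWx.
(* The union with [W] makes [P] hold for the empty set, which is the union of the empty chain. *)
pose P := [set A | absconv (A `|` W) /\ ~ (A `|` W) x].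
have [F FP Ftot|A [[aD nDx] Amax]] := @Zorn_bigcup X P.
  split; last by case=> // -[A FA Ax]; apply: (FP _ FA).2; left.
  split; first by right; apply: absconv0.
  move=> a b y z ab [[A FA Ay]|Wy] [[B FB Bz]|Wz].
  - have [AB|BA] := Ftot _ _ FA FB.
    + have : (B `|` W) (a *: y + b *: z).
        by apply: absconvD (FP _ FB).1 ab _ _; left => //; exact: AB.
      by case=> ?; [left; exists B|right].
    + have : (A `|` W) (a *: y + b *: z).
        by apply: absconvD (FP _ FA).1 ab _ _; left => //; exact: BA.
      by case=> ?; [left; exists A|right].
  - have : (A `|` W) (a *: y + b *: z).
      by apply: absconvD (FP _ FA).1 ab _ _; [left|right].
    by case=> ?; [left; exists A|right].
  - have : (B `|` W) (a *: y + b *: z).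
      by apply: absconvD (FP _ FB).1 ab _ _; [right|left].
    by case=> ?; [left; exists B|right].
  - by right; apply: absconvD.
exists (A `|` W); split => //.
set D := A `|` W in aD nDx *.
move=> y; apply: contrapT => nDy.
have key (d : K) : 0 < d -> exists2 c, `|c| <= d & D (x - c *: y).
  move=> d0; pose D' := msum D (disk (d *: y)).
  have aD' : absconv D' by apply: absconv_msum => //; exact: absconv_disk.
  have DD' : D `<=` D' by apply/msum_subl/absconv_disk.
  have WD' : D' `|` W = D'.
    by apply/setUidPl => z Wz; apply: DD'; right.
  have AD' : A `<` D'.
    split; first by apply: subset_trans DD' => z Az; left.
    move=> D'A; case: nDy; exists d => //; left; apply: D'A.
    exact/(msum_subr aD)/disk_id.
  have : ~ (absconv (D' `|` W) /\ ~ (D' `|` W) x) by exact: Amax.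
  rewrite WD' => /not_andP[/(_ aD')//|/contrapT].
  case=> _ [c c1 ->] Dx; exists (c * d); last by rewrite -scalerA.
  by rewrite normrM (gtr0_norm d0) ler_piMl// ltW.
have [c1 _ D1] := key 1 ltr01.
have c10 : c1 != 0 by apply: contra_notN nDx => /eqP c0; rewrite c0 scale0r subr0 in D1.
(* Since [c1] is nonzero, this bound forces [c2 != c1]; half the difference of the two points of [D]
   is then a nonzero multiple of [y]. *)
have [c2 c2l D2] : exists2 c, `|c| <= `|c1| / 2 & D (x - c *: y).
  by apply: key; rewrite divr_gt0 ?normr_gt0.
have c12 : c2 - c1 != 0.
  rewrite subr_eq0; apply/eqP => cc; rewrite cc in c2l.
  have lt : `|c1| / 2 < `|c1|.
    by rewrite ltr_pdivrMr// ltr_pMr ?normr_gt0// ltr1n.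
  by have := le_lt_trans c2l lt; rewrite ltxx.
apply: nDy.
have := absorbedZ (c2 - c1)^-1 aD (absorbedW (absconv_half aD D1 (absconvN aD D2))).
move=> /(absorbedZ 2 aD).
have e : x - c1 *: y - (x - c2 *: y) = (c2 - c1) *: y.
  by rewrite scalerBl opprB addrC addrA subrK.
rewrite -scalerDr e !scalerA (_ : _ * _ = 1) ?scale1r//.
by field.
Qed.

End AbsolutelyConvex.

(** * Closures in the topology of absorbing neighborhoods *)

Section WeakClosure.
Context (K : numFieldType) (X : preTopologicalLmodType K).
Implicit Types (A B C D V : set X) (x y e : X) (r : K).

(** The type of [X] does not tie its topology to its operations: invariance under translation and
    dilation enters here. The sets [V] need not absorb, since balls of extended seminorms need
    not. *)
Definition locally_absconvex : Prop :=
  (forall x A, nbhs x A <->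
     exists V, [/\ absconv V, nbhs (0 : X) V & forall v, V v -> A (x + v)]) /\
  (forall r V, 0 < r -> nbhs (0 : X) V -> nbhs (0 : X) (dilate r V)).

(* The absolutely convex absorbing neighborhoods of [0] are a base at [0] of
   the finest locally convex topology coarser than the given one; [wclosure]
   is the closure in that topology. *)
Definition absorbing_nbhs D : Prop :=
  [/\ absconv D, forall x, absorbed D x & nbhs (0 : X) D].

Definition wclosure A : set X :=
  [set x | forall D, absorbing_nbhs D -> exists2 d, D d & A (x + d)].

Definition wclosed A : Prop := wclosure A `<=` A.

Lemma absorbing_nbhsI A B :
  absorbing_nbhs A -> absorbing_nbhs B -> absorbing_nbhs (A `&` B).
Proof.
move=> [aA sA nA] [aB sB nB]; split; first exact: absconvI.
  by move=> x; apply: absorbedI.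
exact: filterI.
Qed.

Lemma absorbing_nbhsS A B : absorbing_nbhs A -> absconv B -> A `<=` B ->
  absorbing_nbhs B.
Proof.
move=> [aA sA nA] aB AB; split => //; last exact: filterS nA.
by move=> x; apply: absorbed_sub (sA x).
Qed.

Lemma sub_wclosure A : A `<=` wclosure A.
Proof.
by move=> x Ax D [aD _ _]; exists 0; rewrite ?addr0//; exact: absconv0.
Qed.

Lemma absconv_wclosure A : absconv A -> absconv (wclosure A).
Proof.
move=> aA; split; first exact: sub_wclosure (absconv0 aA).
move=> a b x y ab wx wy D nD; have [aD _ _] := nD.
have [d Dd Ad] := wx D nD; have [d' Dd' Ad'] := wy D nD.
exists (a *: d + b *: d'); first exact: absconvD.
by rewrite addrACA -!scalerDr; apply: absconvD.
Qed.

Section LocallyAbsconvex.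
Hypothesis lcX : locally_absconvex.

Lemma absorbing_nbhs_dilate r D :
  0 < r -> absorbing_nbhs D -> absorbing_nbhs (dilate r D).
Proof.
move=> r0 [aD sD nD]; split; first exact: absconv_dilate.
  by move=> x; apply: absorbed_dilate.
exact: lcX.2.
Qed.

(** Two successive approximations with errors in half of [D] make one with error in [D]. *)
Lemma wclosed_wclosure A : wclosed (wclosure A).
Proof.
move=> x wx D nD; have [aD _ _] := nD.
have h2 : 0 < 2^-1 :> K by rewrite invr_gt0.
have [d Dd wd] := wx _ (absorbing_nbhs_dilate h2 nD).
have [d' Dd' Ad] := wd _ (absorbing_nbhs_dilate h2 nD).
exists (d + d'); last by rewrite addrA.
have := absconv_half aD Dd Dd'.
by rewrite invrK !scalerA mulVf// !scale1r.
Qed.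

Lemma closure_sub_wclosure A : closure A `<=` wclosure A.
Proof.
move=> x cx D [aD _ nD].
have [|y [Ay [d Dd ye]]] := cx [set y | exists2 d, D d & y = x + d].
  by apply/lcX.1; exists D; split => // v Dv; exists v.
by exists d; rewrite -?ye.
Qed.

(** If [x'] and [y'] in [A] approximate [x] and [y] up to [V], the error [a (x' - x) + b (y' - y)]
    is in [V] again. *)
Lemma absconv_closure A : absconv A -> absconv (closure A).
Proof.
move=> aA; split; first exact: subset_closure (absconv0 aA).
move=> a b x y ab cx cy B /lcX.1[V [aV nV VB]].
have nV' (z : X) : nbhs z [set y | V (y - z)].
  by apply/lcX.1; exists V; split => // v Vv; rewrite /= addrAC subrr add0r.
have [x' [Ax' Vx]] := cx _ (nV' x); have [y' [Ay' Vy]] := cy _ (nV' y).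
exists (a *: x' + b *: y'); split; first exact: absconvD.
have := VB _ (absconvD aV ab Vx Vy).
by rewrite !scalerBr addrACA !(addrC (_ *: _) (_ - _)) !subrK.
Qed.

(* The coefficient [c] of [e] in [y + d = a + c e] is forced to be small,
   since [e] is not in the span of [C]. *)
Lemma wclosure_add_disk C e : absconv C -> wclosed C -> ~ absorbed C e ->
  forall y, absorbed C y -> wclosure (msum C (disk e)) y -> C y.
Proof.
move=> aC wC nCe y [t t0 Cty] wy; apply: (wC y) => D nD.
have [aD sD _] := nD.
have [h h0 Dhe] : absorbed (dilate 2^-1 D) e.
  by apply: absorbed_dilate; rewrite ?invr_gt0.
have s0 : 0 < t^-1 + 1 by rewrite addr_gt0 ?invr_gt0.
(* Dividing by [s] gives [t *: y] and the point [a] below coefficients whose moduli [t^-1 / s] and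
   [s^-1] sum to [1]. *)
set s := t^-1 + 1 in s0.
have nCq : ~ C ((h / s) *: e).
  by move=> Cq; apply: nCe; exists (h / s); rewrite ?divr_gt0.
have [D2 nD2 CD2] : exists2 D2, absorbing_nbhs D2 &
    forall d, D2 d -> ~ C ((h / s) *: e + d).
  apply: contrapT => H; apply/nCq/(wC _) => D2 nD2.
  apply: contrapT => H2; apply: H; exists D2 => // d D2d Cd.
  by apply: H2; exists d.
have [aD2 _ _] := nD2.
have h2 : 0 < 2^-1 :> K by rewrite invr_gt0.
have [d [D1d D2d] [_ [c c1 ->] Cyd]] := wy _ (absorbing_nbhsI
  (absorbing_nbhs_dilate h2 nD) (absorbing_nbhs_dilate s0 nD2)).
(* For small [c] both [d] and [c *: e] lie in half of [D], so [d - c *: e] is an admissible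
   error. *)
have [ch|hc] := real_leP (normr_real c) (gtr0_real h0).
  exists (d - c *: e); last by rewrite addrA.
  have Dce : D (2 *: (c *: e)).
    rewrite /dilate/= invrK in Dhe.
    have -> : 2 *: (c *: e) = (c / h) *: (2 *: (h *: e)).
      by rewrite !scalerA; congr (_ *: _); field; rewrite gt_eqF.
    apply: absconv_balanced => //.
    by rewrite normf_div (gtr0_norm h0) ler_pdivrMr// mul1r.
  have := absconv_half aD D1d (absconvN aD Dce).
  by rewrite invrK scalerN !scalerK ?pnatr_eq0.
(* For large [c], solving [a = y + d - c e] for [e] yields a point of [C] in [(h / s) e + D2]. *)
exfalso; have c0 : c != 0 by rewrite -normr_gt0 (lt_trans h0).
set a := y + d - c *: e in Cyd.
have ba : `|h / c| <= 1.
  by rewrite normf_div (gtr0_norm h0) ler_pdivrMr ?normr_gt0// mul1r ltW.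
apply: (CD2 (- ((h / c) *: (s^-1 *: d)))).
  by apply: (absconvN aD2); apply: absconv_balanced.
have -> : (h / s) *: e - (h / c) *: (s^-1 *: d) =
    (h / c) *: ((t^-1 / s) *: (t *: y) + - s^-1 *: a).
  have -> : (t^-1 / s) *: (t *: y) = s^-1 *: y.
    by rewrite scalerA mulrAC mulVf ?gt_eqF// mul1r.
  rewrite scaleNr -scalerBr /a opprB addrCA opprD addNKr !scalerBr !scalerA.
  by congr (_ *: _ - _); field; rewrite c0 gt_eqF.
apply: absconv_balanced => //; apply: absconvD => //.
rewrite normrN !ger0_norm ?divr_ge0 ?invr_ge0 ?(ltW t0) ?(ltW s0)//.
by rewrite -{2}[s^-1]mul1r -mulrDl divff ?gt_eqF.
Qed.

End LocallyAbsconvex.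

(** * Barrels in terms of absolute convexity *)

Lemma balanced_convex_absorbing_of_absconv B : absconv B -> (forall x, absorbed B x) ->
  [/\ balanced B, @convex_set K X B & absorbing B].
Proof.
move=> aB sB; split.
- by move=> c x c1 Bx; apply: absconv_balanced.
- move=> x y l /set_mem Bx /set_mem By; apply/mem_set.
  apply: (absconvD aB _ Bx By).
  by rewrite !ger0_norm ?unstable.onem_ge0 ?unstable.add_onemK.
- move=> x; have [r r0 Bx] := sB x.
  exists r^-1; first by rewrite invr_gt0.
  move=> c rc; have c0 : c != 0.
    by rewrite -normr_gt0 (lt_le_trans _ rc) ?invr_gt0.
  exists (c^-1 *: x); last by rewrite scalerA divff// scale1r.
  rewrite -(mulfK (lt0r_neq0 r0) c^-1) mulrAC -scalerA.
  apply: absconv_balanced => //.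
  by rewrite normf_div normfV (gtr0_norm r0) -invfM invf_le1 ?mulr_gt0 ?normr_gt0// -ler_pdivrMr// mul1r.
Qed.

Lemma absconv_of_barrel B : barrel B -> absconv B /\ forall x, absorbed B x.
Proof.
move=> [_ bB cB sB]; split; last first.
  move=> x; have [r r0 /(_ r)] := sB x; rewrite gtr0_norm// lexx.
  move=> /(_ isT)[b Bb ->]; exists r^-1; first by rewrite invr_gt0.
  by rewrite scalerA mulVf ?gt_eqF// scale1r.
split.
  have [r r0 /(_ r)] := sB 0; rewrite gtr0_norm// lexx => /(_ isT)[b Bb _].
  by rewrite -(scale0r b); apply: bB; rewrite ?normr0.
move=> a b x y ab Bx By.
have [->|a0] := eqVneq a 0.
  rewrite scale0r add0r; apply: bB => //.
  by rewrite (le_trans _ ab)// lerDr.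
have [->|b0] := eqVneq b 0.
  rewrite scale0r addr0; apply: bB => //.
  by rewrite (le_trans _ ab)// lerDl.
(* [a x + b y] is the convex combination, with weights [|a| / s] and [|b| / s], of [(s a / |a|) x]
   and [(s b / |b|) y]; both coefficients have modulus [s <= 1]. *)
set s := `|a| + `|b| in ab.
have s0 : 0 < s by rewrite addr_gt0 ?normr_gt0.
have ge0 : 0 <= `|a| / s by rewrite divr_ge0// ltW.
have le1 : `|a| / s <= 1 by rewrite ler_pdivrMr// mul1r lerDl.
pose l := Itv01 ge0 le1.
have sgn (c : K) : c != 0 -> `|s * (c / `|c|)| <= 1.
  by move=> c0; rewrite normrM normf_div normr_id divff ?normr_eq0// mulr1 gtr0_norm.
have := cB _ _ l (mem_set (bB _ _ (sgn _ a0) Bx)) (mem_set (bB _ _ (sgn _ b0) By)).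
move=> /set_mem; congr B.
rewrite /conv/= !scalerA; congr (_ *: _ + _ *: _).
  by field; rewrite normr_eq0 a0 gt_eqF.
have -> : unstable.onem (`|a| / s) = `|b| / s.
  rewrite /unstable.onem -{1}(divff (lt0r_neq0 s0)) -mulrBl.
  by rewrite /s addrAC subrr add0r.
by field; rewrite normr_eq0 b0 gt_eqF.
Qed.

End WeakClosure.

(** * Consequences of barreledness of the ambient space *)

Section Barreled.
Context (K : numFieldType) (X : preTopologicalLmodType K).
Hypothesis lcX : locally_absconvex X.
Hypothesis barrel_nbhs : forall B : set X, barrel B -> nbhs (0 : X) B.
Implicit Types (B C D U : set X) (x y : X).

(** [closure U] is a barrel, hence a neighborhood of [0], and [wclosure U] contains it. *)
Lemma absorbing_nbhs_wclosure U : absconv U -> (forall x, absorbed U x) ->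
  absorbing_nbhs (wclosure U).
Proof.
move=> aU sU; split; first exact: absconv_wclosure.
  by move=> x; apply: absorbed_sub (sU x); exact: sub_wclosure.
apply: filterS (closure_sub_wclosure lcX (A := U)) _.
apply: barrel_nbhs; have acU := absconv_closure lcX aU.
have scU x : absorbed (closure U) x.
  exact: absorbed_sub (@subset_closure _ U) _ (sU x).
have [? ? ?] := balanced_convex_absorbing_of_absconv acU scU.
by split => //; exact: closed_closure.
Qed.

(* If [x] is in no [C n], choose [D n] with [(x + D n)] disjoint from [C n];
   the intersection of the sets [C n + D n] is still absorbing because each
   point is eventually absorbed by [C n] at a fixed rate. *)
Lemma increasing_wclosed_nbhs (C : nat -> set X) :
  (forall n, absconv (C n)) -> (forall n, wclosed (C n)) ->
  (forall m n, (m <= n)%N -> C m `<=` C n) ->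
  (forall x, exists n, absorbed (C n) x) ->
  nbhs (0 : X) (\bigcup_n C n).
Proof.
move=> aC wC mC sC; have aB := absconv_bigcup aC mC.
set B := \bigcup_n C n in aB *.
have h2 : 0 < 2^-1 :> K by rewrite invr_gt0.
have h4 : 0 < 4^-1 :> K by rewrite invr_gt0.
have sB x : absorbed B x.
  by have [n sx] := sC x; apply: absorbed_sub sx => y Cy; exists n.
(* The weak closure of half of [B] is a neighborhood of [0]; it remains to place it inside [B]. *)
have [_ _] := absorbing_nbhs_wclosure (absconv_dilate 2^-1 aB)
  (fun x => absorbed_dilate h2 (sB x)).
apply: filterS => x wx; apply: contrapT => nBx.
have sepD n : exists D, absorbing_nbhs D /\ forall d, D d -> ~ C n (x + d).
  apply: contrapT => H; apply: nBx; exists n => //; apply: wC => D nD.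
  apply: contrapT => H2; apply: H; exists D; split => // d Dd Cd.
  by apply: H2; exists d.
have [D nD] := choice sepD.
pose E n := msum (C n) (D n).
have nE n : absorbing_nbhs (E n).
  have [aD _ _] := (nD n).1.
  apply: absorbing_nbhsS (nD n).1 _ _; first exact: absconv_msum.
  exact: msum_subr.
have aE n : absconv (E n) by have [] := nE n.
have nEx n : ~ E n x.
  have [aD _ _] := (nD n).1.
  case=> d Dd Cxd; apply: (nD n).2 (- d) _ Cxd.
  exact: absconvN.
(* With the factor [4^-1], a point [d] of [wclosure U] is in half of each [E n]. Then [x], the
   half-sum of [2 (x + d)] and [- 2 d], falls into some [E n]. *)
pose U := dilate 4^-1 (\bigcap_n E n).
have aI : absconv (\bigcap_n E n) by exact: absconv_bigcap.
have aU : absconv U by exact: absconv_dilate.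
have sU y : absorbed U y.
  apply: absorbed_dilate => //; have [m Cy] := sC y.
  have below k : absorbed (\bigcap_(n in [set i | (i < k)%N]) E n) y.
    elim: k => [|k IH]; first by exists 1 => // n /=; rewrite ltn0.
    have [_ sE _] := nE k.
    have := absorbedI (absconv_bigcap (fun n _ => aE n)) (aE k) IH (sE y).
    apply: absorbed_sub => z [Ez Ekz] n /=; rewrite ltnS leq_eqVlt.
    by case/predU1P => [->//|nk]; apply: Ez.
  have above : absorbed (\bigcap_(n in [set i | (m <= i)%N]) E n) y.
    apply: absorbed_sub Cy => z Cz n /= mn.
    have [aD _ _] := (nD n).1.
    by apply: (msum_subl aD); apply: mC mn _ Cz.
  have := absorbedI (absconv_bigcap (fun n _ => aE n))
    (absconv_bigcap (fun n _ => aE n)) (below m) above.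
  apply: absorbed_sub => z [z1 z2] n _.
  by have [/z2|/z1] := leqP m n.
have [d wd [n _ Cn]] := wx _ (absorbing_nbhs_wclosure aU sU).
have [d' E1 E2] := wd _ (absorbing_nbhs_dilate lcX h4 (nE n)).
have {}E2 := E2 n Logic.I.
have Ed : E n (2 *: d).
  have := absconv_half (aE n) E2 (absconvN (aE n) E1).
  rewrite invrK -scalerDr -scalerBr addrK.
  by rewrite scalerA (_ : _ * _ = 2)//; field.
have Exd : E n (2 *: (x + d)).
  have [aD _ _] := (nD n).1.
  by rewrite invrK in Cn; exact: msum_subl Cn.
apply: (nEx n); have := absconv_half (aE n) Exd (absconvN (aE n) Ed).
by rewrite -scalerDr -scalerBr addrK scalerK ?pnatr_eq0.
Qed.

Section Adjoin.
Variable e : X.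

Definition adjoin C : set X :=
  if pselect (absorbed C e) then C else wclosure (msum C (disk e)).

Lemma sub_adjoin C : C `<=` adjoin C.
Proof.
rewrite /adjoin; case: pselect => /= [_|_] x Cx; first by [].
by apply: sub_wclosure; apply: msum_subl => //; exact: absconv_disk.
Qed.

Lemma absconv_adjoin C : absconv C -> absconv (adjoin C).
Proof.
rewrite /adjoin; case: pselect => /= [_|_] aC //.
by apply/absconv_wclosure/absconv_msum => //; exact: absconv_disk.
Qed.

Lemma wclosed_adjoin C : wclosed C -> wclosed (adjoin C).
Proof.
by rewrite /adjoin; case: pselect => /= [_|_] _ //; exact: wclosed_wclosure.
Qed.

Lemma absorbed_adjoin C : absconv C -> absorbed (adjoin C) e.
Proof.
rewrite /adjoin; case: pselect => /= [_|_] aC //.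
apply: absorbedW; apply: sub_wclosure.
by apply: msum_subr => //; exact: disk_id.
Qed.

Lemma adjoin_trace C x : absconv C -> wclosed C ->
  absorbed C x -> adjoin C x -> C x.
Proof.
by rewrite /adjoin; case: pselect => /= [_|nCe] aC wC //; exact: wclosure_add_disk.
Qed.

End Adjoin.

(** That [C] and the [e n] span [X] is phrased as an induction principle over linear subspaces. *)
Lemma nbhs_extending_wclosed C (e : nat -> X) : absconv C -> wclosed C ->
  (forall S : set X, (forall a x y, S x -> S y -> S (a *: x + y)) ->
     absorbed C `<=` S -> (forall n, S (e n)) -> forall x, S x) ->
  exists2 B, nbhs (0 : X) B & forall x, absorbed C x -> B x -> C x.
Proof.
move=> aC0 wC0 gen.
pose F := fix F n := if n is m.+1 then adjoin (e m) (F m) else C.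
have aF n : absconv (F n) by elim: n => //= n; exact: absconv_adjoin.
have wF n : wclosed (F n) by elim: n => //= n; exact: wclosed_adjoin.
have mF m n : (m <= n)%N -> F m `<=` F n.
  elim: n => [|n IH]; first by rewrite leqn0 => /eqP ->.
  rewrite leq_eqVlt => /predU1P[->//|/IH mn].
  exact: subset_trans mn (@sub_adjoin _ _).
exists (\bigcup_n F n).
  apply: increasing_wclosed_nbhs => //.
  (* The subspace is the union of the spans of the stages; [e n] enters at stage [n.+1], as stage
     [0] is [C]. *)
  apply: gen => [a x y [m sx] [n sy]|x sx|n].
  - exists (maxn m n); apply: absorbedD => //; first apply: absorbedZ => //.
      exact: absorbed_sub (mF _ _ (leq_maxl m n)) _ sx.
    exact: absorbed_sub (mF _ _ (leq_maxr m n)) _ sy.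
  - by exists 0%N.
  - by exists n.+1; apply: absorbed_adjoin.
(* Every stage absorbs [x], so membership descends one stage at a time by [adjoin_trace]. *)
move=> x sx [n _]; elim: n => //= n IH Fx; apply: IH.
apply: adjoin_trace Fx => //.
exact: absorbed_sub (mF _ _ (leq0n n)) _ sx.
Qed.

End Barreled.

(** * From families of extended seminorms to neighborhoods of [0] *)

Section SeminormTopology.
Context (K : numFieldType) (X : preTopologicalLmodType K).
Implicit Types (P : set (X -> \bar K)) (V A : set X) (x y : X) (r : K).

(** Finite intersections of balls centred at [0], built one seminorm at a time to allow
    induction. *)
Inductive semiball P : set X -> Prop :=
| semiballT : semiball P setT
| semiballI rho (eps : K) V : P rho -> 0 < eps -> semiball P V ->
    semiball P ([set x | (rho x < eps%:E)%E] `&` V).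

Lemma extended_seminorm_fin (rho : X -> \bar K) x r :
  extended_seminorm rho -> (rho x < r%:E)%E ->
  exists2 p, 0 <= p < r & rho x = p%:E.
Proof.
move=> [rho0 _ _]; have := rho0 x.
case: (rho x) => [p||]//; rewrite lee_fin lte_fin => p0 pr.
by exists p => //; rewrite p0.
Qed.

Lemma extended_seminorm0 (rho : X -> \bar K) :
  extended_seminorm rho -> rho 0 = 0%E.
Proof. by move=> [_ h _]; rewrite -(scale0r 0) h normr0 mul0e. Qed.

Lemma absconv_seminorm_ball (rho : X -> \bar K) r :
  extended_seminorm rho -> 0 < r -> absconv [set x | (rho x < r%:E)%E].
Proof.
move=> srho r0; split; first by rewrite /= extended_seminorm0// lte_fin.
move=> a b x y ab /= /(extended_seminorm_fin srho)[p /andP[p0 pr] xp].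
move=> /(extended_seminorm_fin srho)[q /andP[q0 qr] yq].
have [_ hZ hD] := srho; apply: le_lt_trans (hD _ _) _.
rewrite !hZ xp yq -!EFinM -EFinD lte_fin.
(* [m] is the maximum of [p] and [q], which are comparable because they are nonnegative. *)
have [m m0 [mr pm qm]] : exists2 m, 0 <= m & [/\ m < r, p <= m & q <= m].
  by have [pq|/ltW qp] := real_leP (ger0_real p0) (ger0_real q0);
    [exists q|exists p].
apply: le_lt_trans mr; apply: (@le_trans _ _ ((`|a| + `|b|) * m)).
  by rewrite mulrDl lerD// ler_wpM2l.
by rewrite -[leRHS]mul1r ler_wpM2r.
Qed.

Lemma absconv_semiball P V : P `<=` @extended_seminorm K X ->
  semiball P V -> absconv V.
Proof.
move=> sP; elim=> [|rho eps {}V Prho eps0 _ aV]; first by split.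
by apply: absconvI => //; apply: absconv_seminorm_ball => //; apply: sP.
Qed.

Lemma semiball_dilate P V r : P `<=` @extended_seminorm K X -> 0 < r ->
  semiball P V -> exists2 W, semiball P W & W `<=` dilate r V.
Proof.
move=> sP r0; elim=> [|rho eps {}V Prho eps0 _ [W sW WV]].
  by exists setT; [exact: semiballT|].
exists ([set x | (rho x < (r * eps)%:E)%E] `&` W).
  by apply: semiballI => //; exact: mulr_gt0.
move=> x [/= /(extended_seminorm_fin (sP _ Prho))[p /andP[p0 pr] xp] Wx].
split; last exact: WV; have [_ hZ _] := sP _ Prho.
by rewrite /= hZ xp -EFinM lte_fin gtr0_norm ?invr_gt0// ltr_pdivrMl.
Qed.

Lemma semiball_recenter P U x : P `<=` @extended_seminorm K X ->
  filter.finI_from (seminorm_balls P) id U -> U x ->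
  exists2 V, semiball P V & forall v, V v -> U (x + v).
Proof.
move=> sP [s sub <-] Ux.
have {sub} : {subset enum_fset s <= seminorm_balls P} by move=> A /sub.
have {Ux} : forall A, A \in enum_fset s -> A x by move=> A As; exact: Ux.
rewrite /bigcap/=.
suff H (l : seq (set X)) : (forall A, A \in l -> A x) ->
    {subset l <= seminorm_balls P} ->
    exists2 V, semiball P V & forall v, V v -> forall A, A \in l -> A (x + v).
  by move=> h1 h2; have [V sV hV] := H _ h1 h2; exists V => // v Vv A; apply: hV.
elim: l => [|A l IH] lx sl; first by exists setT => //; exact: semiballT.
have [|B Bl|V sV hV] := IH.
- by move=> B Bl; apply: lx; rewrite inE Bl orbT.
- by apply: sl; rewrite inE Bl orbT.
have : A x by apply: lx; rewrite mem_head.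
have /set_mem[rho [z [eps [Prho eps0 ->]]]] := sl A (mem_head _ _).
move=> /= /(extended_seminorm_fin (sP _ Prho))[p /andP[p0 pe] xp].
(* [eps - p] is the slack that the triangle inequality leaves around [x]. *)
exists ([set v | (rho v < (eps - p)%:E)%E] `&` V).
  by apply: semiballI; rewrite ?subr_gt0.
move=> v [/= /(extended_seminorm_fin (sP _ Prho))[q /andP[q0 qe] vq] Vv] B.
rewrite inE => /predU1P[->|Bl]; last exact: hV.
have [_ _ hD] := sP _ Prho.
rewrite /= addrAC; apply: le_lt_trans (hD _ _) _.
by rewrite xp vq -EFinD lte_fin addrC -ltrBrDr.
Qed.

Lemma semiball_translate P V x : P `<=` @extended_seminorm K X ->
  semiball P V ->
  filter.finI_from (seminorm_balls P) id [set y | V (y - x)].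
Proof.
move=> sP; elim=> [|rho eps {}V Prho eps0 _ IH].
  by exists fset0 => //; apply/seteqP; split.
have -> : [set y | ([set z | (rho z < eps%:E)%E] `&` V) (y - x)] =
  [set y | (rho (y - x)%R < eps%:E)%E] `&` [set y | V (y - x)] by [].
apply: finI_fromI => //.
by apply: (@filter.finI_from1 _ _ (seminorm_balls P) id); exists rho, x, eps.
Qed.

(** Read from left to right it describes the neighborhoods of [X]; from right to left it shows that
    restricted seminorms induce the topology of a subspace. *)
Lemma seminorm_subbaseP P : P `<=` @extended_seminorm K X ->
  is_subbase (seminorm_balls P) <->
  forall x A, nbhs x A <->
    exists2 V, semiball P V & forall v, V v -> A (x + v).
Proof.
move=> sP; split=> [sub x A|hn U].
  rewrite nbhsE; split=> [[U [/sub[D DI ->] [I DI' Ix]] UA]|[V sV VA]].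
    have [V sV VI] := semiball_recenter sP (DI _ DI') Ix.
    by exists V => // v Vv; apply: UA; exists I => //; apply: VI.
  exists [set y | V (y - x)].
    split; last by rewrite /= subrr; exact: absconv0 (absconv_semiball sP sV).
    apply/sub; exists [set [set y | V (y - x)]]; last by rewrite bigcup_set1.
    by move=> _ ->; exact: semiball_translate.
  by move=> y /= /VA; rewrite addrC subrK.
split=> [oU|[D DI ->]].
  exists [set I | filter.finI_from (seminorm_balls P) id I /\ I `<=` U].
    by move=> I [].
  apply/seteqP; split=> [x Ux|x [I [_ IU] Ix]]; last exact: IU.
  have /hn[V sV VU] : nbhs x U by exact: open_nbhs_nbhs.
  exists [set y | V (y - x)].
    split; first exact: semiball_translate.
    by move=> y /= /VU; rewrite addrC subrK.
  by rewrite /= subrr; exact: absconv0 (absconv_semiball sP sV).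
apply: bigcup_open => I /DI fI; rewrite openE => x Ix.
by apply/hn; exact: semiball_recenter fI Ix.
Qed.

Lemma elcs_locally_absconvex : elcs X -> locally_absconvex X.
Proof.
move=> [_ [P sP /(seminorm_subbaseP sP) hn]].
have nV V : semiball P V -> nbhs (0 : X) V.
  by move=> sV; apply/hn; exists V => // v; rewrite add0r.
split=> [x A|r V r0 /hn[W sW WV]].
  rewrite hn; split=> [[V sV VA]|[V [aV /hn[W sW WV] VA]]].
    by exists V; split => //; [exact: absconv_semiball sV|exact: nV].
  by exists W => // v /WV; rewrite add0r => /VA.
have [W' sW' W'W] := semiball_dilate sP r0 sW.
by apply: filterS (nV _ sW') => x /W'W /WV; rewrite add0r.
Qed.

End SeminormTopology.

(** * The subspace [M]: its topology, its barrels, and generators modulo [M] *)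

Section Subspace.
Context (K : numFieldType) (X : preTopologicalLmodType K) (M : submodClosed X).
Let L : preTopologicalLmodType K := linsub M.
Let i : L -> X := val.

Lemma linsub_nbhsP (m : L) (A : set L) :
  nbhs m A <-> exists2 B : set X, nbhs (i m) B & i @^-1` B `<=` A.
Proof.
split=> [|[B nB BA]].
  rewrite nbhsE => -[U [[B oB <-] Bm] UA]; exists B => //.
  exact: open_nbhs_nbhs.
apply: filterS BA _; exact: (@initial_continuous L X i m B nB).
Qed.

(** The semiballs of the restricted seminorms are exactly the traces of the semiballs of [P]. *)
Lemma elcs_linsub : elcs X -> elcs L.
Proof.
move=> [hX [P sP /(seminorm_subbaseP sP) hn]]; split.
  move=> m n mn; apply: val_inj; apply: hX => A B nA nB.
  have [||p [Ap Bp]] := mn (i @^-1` A) (i @^-1` B).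
  - by apply/linsub_nbhsP; exists A.
  - by apply/linsub_nbhsP; exists B.
  - by exists (i p).
pose Q := [set rho \o i | rho in P].
have sQ : Q `<=` @extended_seminorm K L.
  move=> _ [rho /sP[h0 hZ hD] <-]; split=> [m|a m|m n] /=.
  - exact: h0.
  - exact: hZ.
  - exact: hD.
have PQ V : semiball P V -> semiball Q (i @^-1` V).
  elim=> [|rho eps {}V Prho eps0 _ IH]; first exact: semiballT.
  by apply: (@semiballI _ _ _ (rho \o i)) => //; exists rho.
have QP V : semiball Q V -> exists2 W, semiball P W & i @^-1` W = V.
  elim=> [|_ eps {}V [rho Prho <-] eps0 _ [W sW <-]].
    by exists setT; [exact: semiballT|].
  by exists ([set x | (rho x < eps%:E)%E] `&` W); [exact: semiballI|].
exists Q => //; apply/seminorm_subbaseP => // m A; rewrite linsub_nbhsP.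
split=> [[B /hn[V sV VB] BA]|[V sV VA]].
  exists (i @^-1` V); first exact: PQ.
  by move=> v Vv; apply: BA; exact: VB.
have [W sW WV] := QP _ sV.
exists [set x | W (x - i m)].
  by apply/hn; exists W => // v Wv; rewrite /= addrAC subrr add0r.
move=> n /= Wn; rewrite -(subrK m n) addrC; apply: VA.
by rewrite -WV.
Qed.

Lemma absconv_linsub_image (T : set L) :
  absconv T -> absconv [set i n | n in T].
Proof.
move=> aT; split; first by exists 0 => //; exact: absconv0.
move=> a b _ _ ab [x Tx <-] [y Ty <-].
by exists (a *: x + b *: y) => //; exact: absconvD.
Qed.

(* The factor is needed: in a discrete line, where the only extended seminorm
   is infinite off [0], an open disk is a barrel that is not [wclosed]. *)
Lemma barrel_wclosure_trace (T : set L) (m : L) : locally_absconvex X ->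
  closed T -> absconv T -> (forall n, absorbed T n) ->
  wclosure [set i n | n in T] (i m) -> T (2^-1 *: m).
Proof.
move=> lcX cT aT sT wm; apply: contrapT => nTm.
pose T' := [set i n | n in T].
have aT' : absconv T' by exact: absconv_linsub_image.
have : nbhs (2^-1 *: m) (~` T).
  by apply: open_nbhs_nbhs; split => //; exact: closed_openC.
move=> /linsub_nbhsP[B /lcX.1[V [aV nV VB]] BT].
have nW : ~ msum T' V (i (2^-1 *: m)).
  case=> v Vv [n Tn nm]; apply: BT Tn.
  by rewrite /preimage/= nm; apply: VB; exact: absconvN.
have aW : absconv (msum T' V) by exact: absconv_msum.
(* [V] may fail to absorb and so cannot test membership in [wclosure]; its absorbing enlargement [D]
   can, and still avoids half of [m]. *)
have [D [aD WD sD nDm]] := absorbing_avoiding aW nW.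
have nD : absorbing_nbhs D.
  split => //; apply: filterS nV => v Vv.
  by apply: WD; apply: msum_subr.
have [d Dd [n Tn nm]] := wm _ nD.
apply: nDm.
have Dn : D (i n) by apply: WD; apply: msum_subl => //; exists n.
have := absconv_half aD Dn (absconvN aD Dd).
by rewrite nm -scalerDr addrK.
Qed.

(** The [e n] lift a basis of the quotient, and [x] differs from a combination of lifts by an
    element of [M]. *)
Lemma countable_codimension_generators : countable_codimension M ->
  exists e : nat -> X, forall S : set X,
    (forall a x y, S x -> S y -> S (a *: x + y)) ->
    (forall m : L, S (i m)) -> (forall n, S (e n)) -> forall x, S x.
Proof.
move=> [B [_ gB] /countable_injP[f finj]].
(* An index outside the image of [f] gets the class [0], whose representative lies in [M]. *)
pose e n : X := repr (xget 0 [set v | B v /\ f v = n]).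
exists e => S SL SM Se x.
have S0 : S 0 by exact: (SM 0).
have SD y z : S y -> S z -> S (y + z).
  by move=> Sy Sz; rewrite -[y]scale1r; exact: SL.
have SB v : B v -> S (repr v).
  move=> Bv; have := Se (f v); rewrite /e; case: xgetP => [w _ [Bw fw]|/(_ v)[]//].
  by rewrite (finj _ _ _ _ fw)//; exact: mem_set.
have [F [c [FB]]] := gB (\pi_(lmod_quot M)%qT x).
suff [y Sy <-] : exists2 y, S y &
    \pi_(lmod_quot M)%qT y = \sum_(v <- F) c v *: v.
  move=> /eqP; rewrite lmod_quot_eqE => xyM.
  by rewrite -(subrK y x); apply: SD => //; exact: (SM (exist (fun z => z \in M) _ xyM)).
have : forall v, v \in enum_fset F -> B v by move=> v /FB.
elim: (enum_fset F) => [|v l IH] lB.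
  (* The class of [0] is seen to be zero by writing [0] as [0 *: 0]. *)
  exists 0 => //; rewrite big_nil -(scale0r (0 : X)) -lmod_quot_piZ.
  exact: scale0r.
have [|y Sy yl] := IH; first by move=> w wl; apply: lB; rewrite inE wl orbT.
exists (c v *: repr v + y).
  by apply: SL => //; apply: SB; apply: lB; exact: mem_head.
by rewrite big_cons lmod_quot_piD yl -lmod_quot_piZ reprK.
Qed.

Lemma barreled_linsub : barreled X -> countable_codimension M -> barreled L.
Proof.
move=> [eX bX] /countable_codimension_generators[e gen].
split; first exact: elcs_linsub.
move=> T bT; have lcX := elcs_locally_absconvex eX.
have [aT sT] := absconv_of_barrel bT; have [cT _ _ _] := bT.
pose T' := [set i n | n in T].
have aT' : absconv T' by exact: absconv_linsub_image.
have sM (m : L) : absorbed (wclosure T') (i m).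
  have [r r0 Tm] := sT m; exists r => //.
  by apply: sub_wclosure; exists (r *: m).
have [|B nB BT] := @nbhs_extending_wclosed _ X lcX bX (wclosure T') e
  (absconv_wclosure aT') (wclosed_wclosure lcX (A := T')).
  by move=> S SL TS Se x; apply: gen => // m; by apply: TS; exact: sM.
have h2 : 0 < 2^-1 :> K by rewrite invr_gt0.
(* Halving [B] pays for the factor in [barrel_wclosure_trace]: if [2 m] is in [B], it is in the weak
   closure of [T'], whence [m] is in [T]. *)
apply/linsub_nbhsP; exists (dilate 2^-1 B); first exact: lcX.2.
move=> m; rewrite /preimage/dilate/= invrK => Bm.
have two0 : 2 != 0 :> K by rewrite pnatr_eq0.
rewrite -[m](scalerK two0); apply: barrel_wclosure_trace => //.
by apply: BT => //; exact: (sM (2 *: m)).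
Qed.

End Subspace.

Theorem theorem3p20 (R : realType) (k : scalar_kind)
    (X : preTopologicalLmodType (scalars R k)) (M : submodClosed X) :
  barreled X -> countable_codimension M -> barreled (linsub M).
Proof. exact: barreled_linsub. Qed.
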